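(* Let $P_{2n}$ be the path on $2n\geq 4$ vertices with adjacency matrix $A$ and endpoints $u,v$, and let $Q=\mathrm{diag}(Q_1,\dots,Q_n,Q_n,\dots,Q_1)$ be any symmetric real potential. Then perfect state transfer from $u$ to $v$ for the Hamiltonian $H = A - Q$ cannot occur, for any values of $Q_1,\dots,Q_n$.
   Context: With $U(t) = e^{itH}$, perfect state transfer from $u$ to $v$ occurs at time $T$ if $|U(T)_{u,v}|=1$; the claim is that there is no such $T$. *)

(* Defs.v *)
From mathcomp Require Import all_boot all_algebra complex.
From mathcomp Require Import all_classical all_reals all_analysis.
Set Implicit Arguments. Unset Strict Implicit. Unset Printing Implicit Defensive.
Import GRing.Theory Num.Theory numFieldNormedType.Exports.
Local Open Scope ring_scope.

(* k-th power of a square matrix of arbitrary dimension N (N need not be a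
   successor, so we iterate mulmx instead of using the ring power). *)
Definition mxpow (R : pzRingType) (N : nat) (M : 'M[R]_N) (k : nat) : 'M[R]_N :=
  iter k (mulmx M) 1%:M.

Definition path_adj (R : pzRingType) (N : nat) : 'M[R]_N :=
  \matrix_(i, j) (((i : nat) == j.+1) || ((j : nat) == i.+1))%:R.

(* Mirror-symmetric diagonal potential on P_N: vertex i gets the value
   q (min i (N-1-i)); for N = 2n this is diag(Q_1..Q_n,Q_n..Q_1) with
   Q_{k+1} = q k. *)
Definition sym_potential (R : pzRingType) (N : nat) (q : nat -> R) : 'M[R]_N :=
  \matrix_(i, j) ((i == j)%:R * q (minn i (N.-1 - i))).

Definition path_ham (R : pzRingType) (N : nat) (q : nat -> R) : 'M[R]_N :=
  path_adj R N - sym_potential N q.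

(* For real symmetric H, e^{itH} = cos(tH) + i sin(tH), where (entrywise)
   cos(tH) = sum_k (-1)^k t^(2k) H^(2k) / (2k)!  and
   sin(tH) = sum_k (-1)^k t^(2k+1) H^(2k+1) / (2k+1)!
   (the real and imaginary parts of the series sum_k (itH)^k / k!). *)
Definition cos_mx (R : realType) (N : nat) (H : 'M[R]_N) (t : R) (u v : 'I_N) : R :=
  limn (series (fun k : nat => (-1) ^+ k * t ^+ (k.*2) / (k.*2)`!%:R * mxpow H k.*2 u v)).

Definition sin_mx (R : realType) (N : nat) (H : 'M[R]_N) (t : R) (u v : 'I_N) : R :=
  limn (series (fun k : nat => (-1) ^+ k * t ^+ (k.*2.+1) / (k.*2.+1)`!%:R * mxpow H k.*2.+1 u v)).

Definition U_entry (R : realType) (N : nat) (H : 'M[R]_N) (t : R) (u v : 'I_N)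
  : complex R := (cos_mx H t u v +i* sin_mx H t u v)%C.

Definition pst (R : realType) (N : nat) (H : 'M[R]_N) (u v : 'I_N) (T : R) : Prop :=
  `|U_entry H T u v| = 1.

(* Main.v *)
(* The mirror symmetry splits H into the two n x n Jacobi matrices H+ and H- that
   differ only by 2 in their last diagonal entry, and
   2 (H^k)_{uv} = (H+^k)_{00} - (H-^k)_{00}.  Hence U(T)_{uv} is a signed average
   of exp(iT l) over the eigenvalues l of H+ (sign +) and l' of H- (sign -), all
   with nonzero weights of total absolute value 1.  If |U(T)_{uv}| = 1, all these
   phases are aligned, so every T (l_i - l'_j) is an odd multiple of pi:
   l_i - l'_j = s o_ij with s = pi / T and o_ij odd.
   Two identities now clash 2-adically.  The traces give s M = 2 with
   M = sum_i o_ii.  The resultant of the characteristic polynomials,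
   prod_ij (l_i - l'_j) = det p_{H-}(H+), equals +-2^n because
   e_0 p_{H-}(H+) = 2 e_{n-1} and Krylov matrices of e_0 and e_{n-1} have
   determinant +-1.  So M^(n^2) 2^n = +-2^(n^2) * odd, whence n divides 1. *)
Require Import Defs.
From mathcomp Require Import all_boot all_order all_algebra complex.
From mathcomp Require Import all_classical all_reals all_analysis.
From mathcomp Require Import ring lra zify.
Set Implicit Arguments. Unset Strict Implicit. Unset Printing Implicit Defensive.
Import Order.TTheory GRing.Theory Num.Theory numFieldNormedType.Exports.
Local Open Scope ring_scope.

(** * Trigonometry and aligned phases *)

Lemma mxpowE (R : pzRingType) (m : nat) (A : 'M[R]_m.+1) (k : nat) :
  mxpow A k = A ^+ k.
Proof. by elim: k => [|k IH] //; rewrite exprS -IH. Qed.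

Lemma cosN1_odd_pi (R : realType) (x : R) :
  cos x = -1 -> exists k : int, x = (2 * k + 1)%:~R * pi.
Proof.
move=> cx; have pi0 := pi_gt0 R.
(* Reduce [x] modulo [2 pi] to [y] in [[0, 2 pi)]. Injectivity of [cos] on [[0, pi]] then gives
   [y = pi], applied to [2 pi - y] when [y > pi]. *)
pose k := Num.floor (x / (pi *+ 2)); exists k.
have pi2 : 0 < pi *+ 2 :> R by rewrite mulrn_wgt0.
pose y := x - k%:~R * (pi *+ 2).
have /andP[k1 k2] := floor_itv (x / (pi *+ 2)).
rewrite -/k ler_pdivlMr // in k1; rewrite -/k ltr_pdivrMr // intrD mulrDl mul1r in k2.
have cosDk (z : R) (i : int) : cos (z + i%:~R * (pi *+ 2)) = cos z.
  have per := periodicn (@cosD2pi R).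
  case: i => i; first by rewrite mulr_natl per.
  by rewrite NegzE mulrNz mulNr mulr_natl -[in RHS](subrK ((pi *+ 2) *+ i.+1) z) per.
have cy : cos y = -1 by rewrite -(cosDk y k) subrK.
have y0 : 0 <= y by rewrite subr_ge0.
have y2 : y < pi *+ 2 by rewrite ltrBlDl.
suff ypi : y = pi by rewrite -[x](subrK (k%:~R * (pi *+ 2))) -/y ypi; rewrite intrD intrM; ring.
have pin : (pi : R) \in `[0, pi] by rewrite in_itv /= lexx ltW.
have [yle|ygt] := leP y pi.
  by apply: cos_inj => //; rewrite ?in_itv /= ?y0 ?yle // cospi.
have : pi *+ 2 - y = pi.
  apply: cos_inj => //; last by rewrite cospi -cosN opprB cosB cos2pi sin2pi cy; ring.
  rewrite in_itv /=; apply/andP; split; lra.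
by move=> h; lra.
Qed.

(* Equality case of the triangle inequality for [\sum_j c j * exp(i th j)]. *)
Lemma extremal_phases (R : realType) (J : finType) (c th : J -> R) :
  \sum_j `|c j| = 1 ->
  (\sum_j c j * cos (th j)) ^+ 2 + (\sum_j c j * sin (th j)) ^+ 2 = 1 ->
  forall j k, 0 < c j -> c k < 0 -> cos (th j - th k) = -1.
Proof.
move=> c1; set C := \sum_j _; set S := \sum_j _ => CS.
(* With [z = C + iS] of modulus 1, [f j] and [C sin (th j) - S cos (th j)] are the real and
   imaginary parts of [conj z * exp (i th j)]. *)
pose f j := C * cos (th j) + S * sin (th j).
have sq j : f j ^+ 2 + (C * sin (th j) - S * cos (th j)) ^+ 2 = 1.
  have e := cos2Dsin2 (th j); rewrite -[RHS]CS -[RHS]mulr1 -e /f; ring.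
have f1 j : `|f j| <= 1.
  by rewrite -(expr_le1 (n:=2)) // real_normK ?num_real // -(sq j) lerDl sqr_ge0.
have sum1 : \sum_j c j * f j = 1.
  have gen x y : \sum_j c j * (x * cos (th j) + y * sin (th j)) =
      x * (\sum_j c j * cos (th j)) + y * (\sum_j c j * sin (th j)).
    by rewrite !mulr_sumr -big_split /=; apply: eq_bigr => j _; ring.
  by rewrite gen -!expr2.
(* Both sides sum to 1 and the right one is termwise at most the left one, so equality holds term by
   term. *)
have eqc j : `|c j| = c j * f j.
  have le i : c i * f i <= `|c i|.
    by rewrite (le_trans (ler_norm _)) // normrM ler_piMr.
  have : \sum_j (`|c j| - c j * f j) == 0 by rewrite sumrB c1 sum1 subrr.
  rewrite psumr_eq0; last by move=> i _; rewrite subr_ge0.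
  by move=> /allP/(_ j (mem_index_enum _)); rewrite /= subr_eq0 => /eqP.
move=> j k cj ck.
have fj : f j = 1.
  by apply: (mulfI (lt0r_neq0 cj)); rewrite -eqc gtr0_norm ?mulr1.
have fk : f k = -1.
  by apply: (mulfI (ltr0_neq0 ck)); rewrite -eqc ltr0_norm ?mulrN1.
have := sq j; have := sq k; rewrite fj fk sqrrN expr1n.
rewrite cosB => /eqP; rewrite -subr_eq0 addrC addKr sqrf_eq0 => /eqP gk /eqP.
rewrite -subr_eq0 addrC addKr sqrf_eq0 => /eqP gj.
have -> : cos (th j) * cos (th k) + sin (th j) * sin (th k) =
  (C ^+ 2 + S ^+ 2) * (cos (th j) * cos (th k) + sin (th j) * sin (th k)) by rewrite CS mul1r.
transitivity (f j * f k + (C * sin (th j) - S * cos (th j)) * (C * sin (th k) - S * cos (th k))).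
  by rewrite /f; ring.
by rewrite gj mul0r addr0 fj fk mul1r.
Qed.

(** * Spectral expansions *)

Lemma U_entry_spectral (R : realType) (N : nat) (H : 'M[R]_N) (u v : 'I_N)
    (J : finType) (c l : J -> R) (t : R) :
  (forall k, mxpow H k u v = \sum_j c j * l j ^+ k) ->
  U_entry H t u v =
    ((\sum_j c j * cos (t * l j)) +i* (\sum_j c j * sin (t * l j)))%C.
Proof.
move=> HE.
have lin (g : R -> nat -> R) (G : R -> R) (a : nat -> R) (e : nat -> nat) :
    (forall x k, g x k = a k * x ^+ e k) ->
    (forall x, series (g x) @ \oo --> G x)%classic ->
    limn (series (fun k => a k * t ^+ e k * mxpow H (e k) u v)) =
      \sum_j c j * G (t * l j).
  move=> gE gG; apply/cvg_lim => //.
  have -> : series (fun k => a k * t ^+ e k * mxpow H (e k) u v) =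
      (fun n => \sum_j c j * series (g (t * l j)) n).
    apply/funext => n; rewrite /series /=.
    under [RHS]eq_bigr do rewrite mulr_sumr.
    rewrite exchange_big /=; apply: eq_bigr => k _.
    rewrite HE mulr_sumr; apply: eq_bigr => j _; rewrite gE exprMn; ring.
  apply: cvg_big => [|j _]; first exact: add_continuous.
  by apply: cvgMr; exact: gG.
rewrite /U_entry /cos_mx /sin_mx; congr (_ +i* _)%C.
  rewrite -(lin (@cos_coeff' R) (@cos R) (fun k => (-1) ^+ k / (k.*2)`!%:R) double) //.
  - congr (limn (series _)); apply/funext => k; congr (_ * _); exact: mulrAC.
  - by move=> x k; exact: mulrAC.
  - exact: cvg_cos_coeff'.
rewrite -(lin (@sin_coeff' R) (@sin R) (fun k => (-1) ^+ k / (k.*2.+1)`!%:R) (fun k => k.*2.+1)) //.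
- congr (limn (series _)); apply/funext => k; congr (_ * _); exact: mulrAC.
- by move=> x k; exact: mulrAC.
- exact: cvg_sin_coeff'.
Qed.

Lemma horner_conj_diag (F : fieldType) (m : nat) (P : 'M[F]_m.+1)
    (d : 'rV[F]_m.+1) (p : {poly F}) : P \in unitmx ->
  horner_mx (invmx P *m diag_mx d *m P) p =
  invmx P *m diag_mx (map_mx (horner p) d) *m P.
Proof. by move=> Pu; rewrite horner_mx_uconjC // horner_mx_diag. Qed.

(** Over the complex numbers [A] is Hermitian, hence unitarily diagonalizable with real eigenvalues
    [l j]. The weights are [w j = |P j i|^2] for the diagonalizing unitary [P]. *)
Lemma symmetric_spectrum (R : rcfType) (m : nat) (A : 'M[R]_m.+1) (i : 'I_m.+1) :
  A^T = A -> exists l w : 'I_m.+1 -> R,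
  [/\ forall p, \det (horner_mx A p) = \prod_j p.[l j],
      \tr A = \sum_j l j,
      forall p, horner_mx A p i i = \sum_j w j * p.[l j],
      forall p, (forall j, p.[l j] = 0) -> horner_mx A p = 0 &
      forall j, 0 <= w j].
Proof.
move=> Asym; pose toC := real_complex R; pose AC := map_mx toC A.
have AH : AC \is hermsymmx.
  apply: realsym_hermsym.
    by apply/is_hermitianmxP/matrixP => a b; rewrite expr0 scale1r !mxE -[in LHS]Asym mxE.
  by apply/mxOverP => a b; rewrite mxE complex_real.
have /orthomx_spectralP := hermitian_normalmx AH.
have := spectral_unitarymx AC; have := hermitian_spectral_diag_real AH.
set P := spectralmx AC; set d := spectral_diag AC => dreal Pu ACE.
pose l j := complex.Re (d 0 j).
have dE : d = map_mx toC (\row_j l j).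
  apply/rowP => j; rewrite !mxE /l /toC RRe_real //.
  exact: (mxOverP dreal).
have Punit := unitarymx_unit Pu.
have dpE p : map_mx (horner (map_poly toC p)) d = \row_j toC p.[l j].
  by rewrite dE; apply/rowP => j; rewrite !mxE; exact: horner_map.
have hE p : map_mx toC (horner_mx A p) = invmx P *m diag_mx (\row_j toC p.[l j]) *m P.
  by rewrite map_horner_mx -/AC ACE (horner_conj_diag d _ Punit) dpE.
exists l, (fun j => complex.Re (P j i * (P j i)^*)); split.
- move=> p; apply: (@complexI R); rewrite -[LHS]det_map_mx hE !det_mulmx mulrAC -det_mulmx.
  rewrite mulVmx // det1 mul1r det_diag rmorph_prod.
  by apply: eq_bigr => j _; rewrite mxE.
- apply: (@complexI R); rewrite -[LHS]trace_map_mx.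
  rewrite -/toC -/AC ACE mxtrace_mulC mulmxA mulmxV // mul1mx mxtrace_diag /toC rmorph_sum.
  by apply: eq_bigr => j _; rewrite dE !mxE.
- move=> p; have := congr1 (fun M : 'M[_]_(m.+1) => M i i) (hE p).
  rewrite mxE => /(congr1 (@complex.Re R)); move=> /= ->; rewrite invmx_unitary //.
  rewrite mul_mx_diag mxE raddf_sum; apply: eq_bigr => j _ /=.
  by rewrite !mxE; case: (P j i) => a b /=; ring.
- move=> p p0; apply: (map_mx_inj (f := toC)).
  rewrite hE map_mx0 (_ : \row__ _ = 0) ?linear0 ?mulmx0 ?mul0mx //.
  by apply/rowP => j; rewrite !mxE p0.
- move=> j; have := mul_conjC_ge0 (P j i); by rewrite lecE => /andP[].
Qed.

(** * Hessenberg and Krylov matrices *)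

Section Hessenberg.
Variables (R : comNzRingType) (m : nat).
Implicit Types A B : 'M[R]_m.+1.

(* Lower Hessenberg with superdiagonal 1: nothing is required on and below the
   diagonal. *)
Definition unit_hessenberg A :=
  forall i j : 'I_m.+1, (i < j)%N -> A i j = (j == i.+1 :> nat)%:R.

(** A walk moves up by at most one vertex per step, with weight 1. In [k] steps from 0 it cannot
    pass [k], and it reaches [k] in exactly one way. *)
Lemma hessenberg_pow A (k : nat) (j : 'I_m.+1) : unit_hessenberg A ->
  (k <= j)%N -> (A ^+ k) ord0 j = (j == k :> nat)%:R.
Proof.
move=> hA; elim: k j => [|k IH] j kj; first by rewrite expr0 mxE eq_sym.
have km : (k < m.+1)%N by rewrite (leq_trans kj) // ltnW.
rewrite exprSr mxE (bigD1 (Ordinal km)) //= big1 ?addr0.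
  by rewrite IH //= eqxx mul1r hA.
move=> i; rewrite -val_eqE /= => ik; have [ki|ki] := leqP k i.
  by rewrite IH // (negbTE ik) mul0r.
by rewrite hA ?(ltn_trans ki) // [_ == _]gtn_eqF ?mulr0 // (leq_trans _ kj).
Qed.

Lemma hessenberg_horner A (p : {poly R}) : unit_hessenberg A ->
  (size p <= m.+1)%N -> (horner_mx A p) ord0 ord_max = p`_m.
Proof.
move=> hA sp; rewrite -[in LHS](coefK p) poly_def rmorph_sum summxE.
rewrite (eq_bigr (fun i : 'I_(size p) => p`_i * (i == m :> nat)%:R)) => [|i _]; last first.
  rewrite /= horner_mxZ rmorphXn /= horner_mx_X mxE.
  by rewrite hessenberg_pow // ?[m == i]eq_sym // -ltnS (leq_trans _ sp).
have [ms|sm] := ltnP m (size p).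
  rewrite (bigD1 (Ordinal ms)) //= eqxx mulr1 big1 ?addr0 // => i.
  by rewrite -val_eqE /= => /negbTE ->; rewrite mulr0.
rewrite nth_default // big1 // => i _.
by rewrite ltn_eqF ?mulr0 // (leq_trans _ sm).
Qed.

(** A walk from 0 needs [m] steps to reach the modified corner, so the loop of weight [c] is first
    felt in the power [m.+1], and then only as the last step. *)
Lemma hessenberg_rank1_horner A (c : R) (p : {poly R}) : unit_hessenberg A ->
  (size p <= m.+2)%N ->
  row ord0 (horner_mx (A + c *: delta_mx ord_max ord_max) p) =
  row ord0 (horner_mx A p) + (c * p`_m.+1) *: delta_mx 0 ord_max.
Proof.
move=> hA; set B := A + _ => sp.
have low k : (k <= m)%N -> row ord0 (B ^+ k) = row ord0 (A ^+ k).
  elim: k => // k IH km; rewrite !exprSr !row_mul IH 1?ltnW // mulmxDr.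
  rewrite [X in _ + X](_ : _ = 0) ?addr0 // -scalemxAr -row_mul.
  apply/rowP => j; rewrite !mxE big1 ?mulr0 // => i _; rewrite !mxE.
  case: eqP => [->|_]; last by rewrite mulr0.
  by rewrite hessenberg_pow ?(ltnW km) //= gtn_eqF ?mul0r.
have top : row ord0 (B ^+ m.+1) = row ord0 (A ^+ m.+1) + c *: delta_mx 0 ord_max.
  rewrite !exprSr !row_mul low // mulmxDr; congr (_ + _).
  rewrite -scalemxAr -row_mul; congr (_ *: _).
  apply/rowP => j; rewrite !mxE (bigD1 ord_max) //= big1 ?addr0 => [|i im].
    by rewrite hessenberg_pow //= !mxE !eqxx mul1r.
  by rewrite mxE (negbTE im) mulr0.
have pE (C : 'M[R]_m.+1) : row ord0 (horner_mx C p) =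
    \sum_(i < m.+2) p`_i *: row ord0 (C ^+ i).
  rewrite -[in LHS](take_poly_id sp) [take_poly _ _]poly_def rmorph_sum raddf_sum; apply: eq_bigr => i _.
  by rewrite /= horner_mxZ rmorphXn /= horner_mx_X; apply/rowP => j; rewrite !mxE.
rewrite !pE big_ord_recr [in RHS]big_ord_recr /= top scalerDr scalerA mulrC -!addrA; congr (_ + _).
  by apply: eq_bigr => i _; rewrite low // -ltnS.
Qed.

Definition krylov A (v : 'rV[R]_m.+1) : 'M[R]_m.+1 := \matrix_(k < m.+1) (v *m A ^+ k).

Lemma det_krylov0 A : unit_hessenberg A -> \det (krylov A (delta_mx 0 ord0)) = 1.
Proof.
move=> hA; rewrite det_trig.
  apply: big1 => i _; rewrite mxE -rowE mxE hessenberg_pow ?eqxx //.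
apply/is_trig_mxP => i j ij; rewrite mxE -rowE mxE hessenberg_pow ?(ltnW ij) //.
by rewrite gtn_eqF.
Qed.

Let J : 'M[R]_m.+1 := \matrix_(i, j) (j == rev_ord i)%:R.

(* Conjugation by [J] reverses the order of the vertices and reduces this to
   [det_krylov0]; the square absorbs the sign of the reversal. *)
Lemma det_krylov_max A : unit_hessenberg A -> unit_hessenberg A^T ->
  \det (krylov A (delta_mx 0 ord_max)) ^+ 2 = 1.
Proof.
move=> hA hAT.
have JJ : J *m J = 1%:M.
  apply/matrixP => i j; rewrite !mxE (bigD1 (rev_ord i)) //= big1 => [|k ki].
    by rewrite !mxE rev_ordK !eqxx mul1r addr0 eq_sym.
  by rewrite mxE (negbTE ki) mul0r.
have JC C i j : (J *m C *m J) i j = C (rev_ord i) (rev_ord j).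
  rewrite mxE (bigD1 (rev_ord j)) //= big1 => [|k kj].
    rewrite !mxE rev_ordK eqxx mulr1 addr0 (bigD1 (rev_ord i)) //= big1 => [|k ki].
      by rewrite !mxE eqxx mul1r addr0.
    by rewrite mxE (negbTE ki) mul0r.
  rewrite [J k j]mxE (_ : (j == rev_ord k) = false) ?mulr0 //.
    by apply: contraNF kj => /eqP ->; rewrite rev_ordK.
pose B := J *m A *m J.
have hB : unit_hessenberg B.
  move=> i j ij; rewrite JC.
  have := hAT (rev_ord j) (rev_ord i); rewrite mxE => ->; rewrite /=; last by have := ltn_ord j; lia.
  by congr (nat_of_bool _)%:R; have := ltn_ord j; lia.
have BX k : B ^+ k *m J = J *m A ^+ k.
  have BJ : B *m J = J *m A by rewrite /B -mulmxA JJ mulmx1.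
  elim: k => [|k IH]; first by rewrite !expr0 mulmx1 mul1mx.
  by rewrite !exprSr -[LHS]mulmxA BJ mulmxA IH -mulmxA.
have -> : krylov A (delta_mx 0 ord_max) = krylov B (delta_mx 0 ord0) *m J.
  apply/row_matrixP => k; rewrite row_mul !rowK -mulmxA BX mulmxA; congr (_ *m _).
  rewrite -rowE; apply/rowP => j; rewrite !mxE; congr (nat_of_bool _)%:R.
  by rewrite -!val_eqE /= subn1.
rewrite det_mulmx det_krylov0 // mul1r expr2 -det_mulmx JJ; exact: det1.
Qed.

(* With [A' := A - c E_mm], the rows [e_0 A^k] and [e_0 A'^k] agree for [k <= m]
   and differ by [c e_m] at [k = m.+1], so [p A' = 0] gives [e_0 (p A) = c e_m];
   multiplying by the powers of [A] relates the two Krylov matrices. *)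
Lemma det_horner_rank1 A (c : R) (p : {poly R}) :
  unit_hessenberg A -> unit_hessenberg A^T -> p \is monic -> size p = m.+2 ->
  horner_mx (A - c *: delta_mx ord_max ord_max) p = 0 ->
  \det (horner_mx A p) ^+ 2 = (c ^+ m.+1) ^+ 2.
Proof.
move=> hA hAT pm sp p0.
have := @hessenberg_rank1_horner A (- c) p hA; rewrite sp => /(_ (leqnn _)).
rewrite scaleNr p0 row0 (_ : p`_m.+1 = 1); last by move/monicP: pm; rewrite lead_coefE sp.
rewrite mulr1 scaleNr => /eqP; rewrite eq_sym subr_eq0 => /eqP rE.
have : krylov A (delta_mx 0 ord0) *m horner_mx A p = c *: krylov A (delta_mx 0 ord_max).
  apply/row_matrixP => k; rewrite row_mul linearZ /= !rowK -mulmxA.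
  have -> : A ^+ k *m horner_mx A p = horner_mx A p *m A ^+ k.
    by rewrite -[A in A ^+ k](horner_mx_X) -rmorphXn; apply: comm_horner_mx2.
  by rewrite mulmxA -rowE rE scalemxAl.
move=> /(congr1 determinant); rewrite det_mulmx det_krylov0 // mul1r detZ => ->.
by rewrite exprMn det_krylov_max // mulr1.
Qed.
End Hessenberg.

(** * The 2-adic contradiction *)

(* The 2-adic valuations give [N * (N * v + 1) = N * N], hence [N %| 1]. *)
Lemma odd_prod_sum_contra (N a b : nat) : (2 <= N)%N -> odd b ->
  (a ^ (N * N) * 2 ^ N = 2 ^ (N * N) * b)%N -> False.
Proof.
move=> N2 ob e; have b0 : (0 < b)%N by case: b ob {e}.
have a0 : (0 < a)%N.
  case: a e => // /esym/eqP; rewrite exp0n ?muln_gt0 ?(ltnW N2) // mul0n.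
  by rewrite muln_eq0 expn_eq0 /= => /eqP b0'; rewrite b0' in b0.
have := congr1 (logn 2) e.
rewrite !lognM ?expn_gt0 ?a0 // !lognX (@logn_prime 2 2) // muln1 muln1.
rewrite (@lognE 2 b) b0 dvdn2 ob /= addn0 -mulnA addnC -mulnS => /eqP.
rewrite eqn_pmul2l ?(ltnW N2) // => /eqP h.
have : (N %| 1)%N by rewrite -(@dvdn_addl (N * logn 2 a)) ?dvdn_mulr // add1n h.
by rewrite dvdn1; case: N N2 {e h} => [|[|]].
Qed.

Lemma no_odd_gap_array (R : realFieldType) (N : nat) (s : R)
    (f : 'I_N -> 'I_N -> int) : (2 <= N)%N ->
  \sum_i s * (2 * f i i + 1)%:~R = 2 ->
  (\prod_i \prod_j (s * (2 * f i j + 1)%:~R)) ^+ 2 = (2 ^+ N) ^+ 2 -> False.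
Proof.
move=> N2 fs fp.
pose M : int := \sum_i (2 * f i i + 1).
pose b : int := \prod_i \prod_j (2 * f i j + 1).
have sM : s * M%:~R = 2 by rewrite -fs /M rmorph_sum mulr_sumr.
have pE : \prod_i \prod_j (s * (2 * f i j + 1)%:~R) = s ^+ (N * N) * b%:~R.
  under eq_bigr do rewrite big_split /= prodr_const card_ord.
  rewrite big_split /= prodr_const card_ord -exprM /b rmorph_prod.
  by congr (_ * _); apply: eq_bigr => i _; rewrite rmorph_prod.
have ob : odd `|b|.
  have oddM (x y : int) : odd `|x| -> odd `|y| -> odd `|(x * y : int)|.
    by rewrite abszM oddM => -> ->.
  apply: (big_ind (fun z : int => odd `|z|)) => // i _.
  apply: (big_ind (fun z : int => odd `|z|)) => // j _; lia.
(* Replacing the 2 on the right by [s * M] reduces this to [fp] and eliminates [s]. The squares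
   absorb the unknown sign of the product. *)
have key : (M ^+ (N * N) * 2 ^+ N) ^+ 2 = (2 ^+ (N * N) * b) ^+ 2.
  apply: (@intr_inj R); rewrite !(rmorphXn, rmorphM) /=.
  rewrite (_ : 2%:~R = 2 :> R) // -[X in _ = (X ^+ _ * _) ^+ _]sM.
  by rewrite [LHS]exprMn -fp pE [(s * _) ^+ _]exprMn; ring.
have : `|(M ^+ (N * N) * 2 ^+ N)%R|%N = `|(2 ^+ (N * N) * b)%R|%N.
  apply/eqP; rewrite -(eqn_exp2r _ _ (e := 2)) //.
  by rewrite -!abszX key.
rewrite !abszM !abszX; exact: odd_prod_sum_contra.
Qed.

(** * Folding the path along its mirror symmetry *)

(* The path Hamiltonian on the first half of the vertices, with a loop of weight
   [c] at the inner end; [c = 1] and [c = -1] are its restrictions to the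
   mirror-symmetric and antisymmetric vectors. *)
Definition half_path (R : pzRingType) (m : nat) (q : nat -> R) (c : R) : 'M[R]_m.+1 :=
  \matrix_(i, j) ((((i : nat) == j.+1) || ((j : nat) == i.+1))%:R - (i == j)%:R * q i)
  + c *: delta_mx ord_max ord_max.

(** Row [a] is [e_a] plus [c] times the basis vector at the mirror image of [a]. *)
Definition fold_mx (R : pzRingType) (m : nat) (c : R) : 'M[R]_(m.+1, (m.+1).*2) :=
  \matrix_(a, j) ((a == j :> nat)%:R + c * ((a + j)%N == (m.+1).*2.-1)%:R).

Lemma sum_pred1 (R : pzSemiRingType) (T : finType) (k0 : T) (P : pred T) (F : T -> R) :
  P =1 pred1 k0 -> \sum_k (P k)%:R * F k = F k0.
Proof.
move=> PE; rewrite (bigD1 k0) //= PE /= eqxx mul1r big1 ?addr0 // => k.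
by rewrite PE /= => /negbTE ->; rewrite mul0r.
Qed.

(** Mirroring commutes with the Hamiltonian. The middle edge joins [m] to its own mirror image, so
    folding turns it into a loop of weight [c]; seen from the right half this loop gets weight
    [c * c = 1]. *)
Lemma fold_path_ham (R : comPzRingType) (m : nat) (q : nat -> R) (c : R) : c * c = 1 ->
  fold_mx m c *m path_ham (m.+1).*2 q = half_path m q c *m fold_mx m c.
Proof.
move=> cc; apply/matrixP => a j; rewrite !mxE.
have an := ltn_ord a; have jn := ltn_ord j.
have a1 : (a < (m.+1).*2)%N by lia.
have a2 : ((m.+1).*2.-1 - a < (m.+1).*2)%N by lia.
under eq_bigr do rewrite mxE mulrDl -mulrA.
rewrite big_split /= -mulr_sumr (sum_pred1 (k0 := Ordinal a1)); last first.
  by move=> k /=; rewrite -val_eqE eq_sym.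
rewrite (sum_pred1 (k0 := Ordinal a2)); last first.
  by move=> k /=; rewrite -val_eqE /=; have := ltn_ord k; lia.
under [RHS]eq_bigr do rewrite [fold_mx _ _ _ _]mxE mulrC mulrDl -mulrA.
rewrite big_split /= -mulr_sumr.
(* In the fold, a column of the left half meets only the direct term and a column of the right half
   only the mirror term. *)
have [jm|mj] := leqP j m.
  rewrite (sum_pred1 (k0 := Ordinal (jm : (j < m.+1)%N))) => [|k]; last by rewrite /= -val_eqE.
  rewrite [X in _ = _ + c * X]big1 => [|k _]; last first.
    by rewrite (_ : (_ == _) = false) ?mul0r //; have := ltn_ord k; lia.
  rewrite !mxE -!val_eqE /= mulr0 addr0.
  have -> : minn a ((m.+1).*2.-1 - a) = a by lia.
  have -> : ((m.+1).*2.-1 - a == j)%N = false by lia.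
  have -> : ((m.+1).*2.-1 - a == j.+1)%N || (j == ((m.+1).*2.-1 - a).+1 :> nat) =
    ((a == m :> nat) && (j == m :> nat)) by lia.
  by rewrite mul0r subr0.
have j2 : ((m.+1).*2.-1 - j < m.+1)%N by lia.
rewrite [X in _ = X + _]big1 => [|k _]; last first.
  by rewrite (_ : (_ == _) = false) ?mul0r //; have := ltn_ord k; lia.
rewrite (sum_pred1 (k0 := Ordinal j2)) => [|k]; last by rewrite /= -val_eqE /=; have := ltn_ord k; lia.
rewrite !mxE -!val_eqE /= add0r.
have -> : (a == j :> nat) = false by lia.
have -> : minn ((m.+1).*2.-1 - a) ((m.+1).*2.-1 - ((m.+1).*2.-1 - a)) = a by lia.
have -> : ((m.+1).*2.-1 - a == j)%N = (a == (m.+1).*2.-1 - j :> nat)%N by lia.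
have -> : ((m.+1).*2.-1 - a == j.+1)%N || (j == ((m.+1).*2.-1 - a).+1 :> nat) =
  (a == ((m.+1).*2.-1 - j).+1 :> nat) || ((m.+1).*2.-1 - j == a.+1 :> nat)%N by lia.
have -> : ((a == j.+1 :> nat) || (j == a.+1 :> nat)) =
    ((a == m :> nat) && ((m.+1).*2.-1 - j == m)%N) by lia.
by rewrite mul0r subr0 [RHS]mulrDr [c * (c * _)]mulrA cc mul1r [RHS]addrC.
Qed.

Lemma mxpow_path_ham (R : comPzRingType) (m : nat) (q : nat -> R)
    (u v : 'I_((m.+1).*2)) (k : nat) :
  val u = 0%N -> val v = (m.+1).*2.-1 ->
  mxpow (path_ham (m.+1).*2 q) k u v *+ 2 =
  (mxpow (half_path m q 1) k - mxpow (half_path m q (-1)) k) ord0 ord0.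
Proof.
move=> hu hv; set P := path_ham _ q; have vE : (v : nat) = (m.+1).*2.-1 by [].
(* This is entry [(0, v)] of the intertwining relation for [k]-th powers. Combining [c = 1] and
   [c = -1] cancels the return term at [v]. *)
have comm (c : R) : c * c = 1 ->
    mxpow P k u v + c * mxpow P k v v = c * mxpow (half_path m q c) k ord0 ord0.
  move=> cc.
  have : fold_mx m c *m mxpow P k = mxpow (half_path m q c) k *m fold_mx m c.
    elim: k => [|k IH]; first by rewrite /mxpow /= mulmx1 mul1mx.
    by rewrite /mxpow !iterS -!/(mxpow _ _) mulmxA fold_path_ham // -!mulmxA IH.
  move=> /matrixP/(_ ord0 v); rewrite !mxE.
  under eq_bigr do rewrite mxE mulrDl -mulrA.
  rewrite big_split /= -mulr_sumr (sum_pred1 (k0 := u)); last first.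
    by move=> i; rewrite /= -val_eqE hu eq_sym.
  rewrite (sum_pred1 (k0 := v)); last by move=> i; rewrite /= -val_eqE hv add0n.
  move=> ->; under eq_bigr do rewrite mxE mulrC mulrDl -mulrA.
  rewrite big_split /= -mulr_sumr big1 => [|i _]; last first.
    by rewrite (_ : (_ == _) = false) ?mul0r //; have := ltn_ord i; lia.
  rewrite add0r (sum_pred1 (k0 := ord0)) // => i.
  by rewrite /= -val_eqE hv /=; lia.
have := comm 1 (mulr1 1); have := comm (-1); rewrite mulrNN mulr1 => /(_ erefl).
by rewrite !mulN1r !mul1r !mxE => <- <-; rewrite mulr2n [RHS]addrACA subrr addr0.
Qed.

(** * Positive weights, odd gaps and the conclusion *)

Lemma trmx_horner (R : comNzRingType) (m : nat) (A : 'M[R]_m.+1) (p : {poly R}) :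
  (horner_mx A p)^T = horner_mx A^T p.
Proof.
elim/poly_ind: p => [|p c IH]; first by rewrite !rmorph0 trmx0.
rewrite !rmorphD !rmorphM /= !horner_mx_X !horner_mx_C linearD /= tr_scalar_mx.
rewrite -[(_ * _)^T]/((_ *m _)^T) trmx_mul IH; congr (_ + _).
by have := comm_horner_mx2 A^T 'X p; rewrite horner_mx_X.
Qed.

(* If [w j = 0], take [p := \prod_(k != j) ('X - l k)]: then [e_0 (p A)] has square
   norm [\sum_k w k * p.[l k] ^+ 2 = 0], while its last entry is 1. *)
Lemma hessenberg_weight_neq0 (R : realDomainType) (m : nat) (A : 'M[R]_m.+1)
    (l w : 'I_m.+1 -> R) : unit_hessenberg A -> A^T = A ->
  (forall p, horner_mx A p ord0 ord0 = \sum_j w j * p.[l j]) ->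
  forall j, w j != 0.
Proof.
move=> hA sA spec j; apply/eqP => wj.
pose p := \prod_(k | k != j) ('X - (l k)%:P).
have pm : p \is monic by apply: monic_prod_XsubC.
have sp : size p = m.+1.
  rewrite /p -big_filter size_prod_XsubC -cardE; have := cardC1 j.
  by rewrite card_ord => ->.
have : horner_mx A (p * p) ord0 ord0 == 0.
  rewrite spec big1 // => k _; have [->|kj] := eqVneq k j; first by rewrite wj mul0r.
  by rewrite hornerM /p horner_prod (bigD1 k) //= hornerXsubC subrr !mul0r mulr0.
have symE k : horner_mx A p k ord0 = horner_mx A p ord0 k.
  by rewrite -[in LHS]sA -trmx_horner mxE.
rewrite rmorphM /= mxE psumr_eq0 => [/allP/(_ ord_max (mem_index_enum _))|k _].
  rewrite symE mulf_eq0 orbb hessenberg_horner ?sp //.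
  by have := monicP pm; rewrite lead_coefE sp /= => ->; rewrite oner_eq0.
by rewrite symE; exact: sqr_ge0.
Qed.

Lemma pst_path_phases (R : realType) (m : nat) (q : nat -> R)
    (u v : 'I_((m.+1).*2)) (T : R) :
  val u = 0%N -> val v = (m.+1).*2.-1 -> pst (path_ham (m.+1).*2 q) u v T ->
  forall l w l' w' : 'I_m.+1 -> R,
  (forall p, horner_mx (half_path m q 1) p ord0 ord0 = \sum_j w j * p.[l j]) ->
  (forall p, horner_mx (half_path m q (-1)) p ord0 ord0 = \sum_j w' j * p.[l' j]) ->
  (forall j, 0 < w j) -> (forall j, 0 < w' j) ->
  forall i j, cos (T * (l i - l' j)) = -1.
Proof.
move=> hu hv hpst l w l' w' spec spec' w0 w0' i j.
(* The two summands index the symmetric and antisymmetric spectra. The halves undo the doubling in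
   [mxpow_path_ham]; as each family of weights sums to 1 (take the polynomial 1), the total absolute
   weight is 1. *)
pose c (x : 'I_m.+1 + 'I_m.+1) := match x with inl a => w a / 2 | inr b => - (w' b / 2) end.
pose th (x : 'I_m.+1 + 'I_m.+1) := match x with inl a => l a | inr b => l' b end.
have HE k : mxpow (path_ham (m.+1).*2 q) k u v = \sum_x c x * th x ^+ k.
  have := mxpow_path_ham q k hu hv; rewrite !(mxpowE (half_path _ _ _)) !mxE.
  have pow A : A ^+ k = horner_mx A 'X^k :> 'M[R]_m.+1 by rewrite rmorphXn /= horner_mx_X.
  rewrite !pow spec spec' big_sumType /= => e.
  transitivity (mxpow (path_ham (m.+1).*2 q) k u v *+ 2 / 2); first by field.
  rewrite e mulrBl !mulr_suml -sumrN; congr (_ + _); apply: eq_bigr => a _;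
    by rewrite hornerXn; field.
have w1 (A : 'M[R]_m.+1) (x y : 'I_m.+1 -> R) :
    (forall p, horner_mx A p ord0 ord0 = \sum_j x j * p.[y j]) -> \sum_j x j = 1.
  move=> /(_ 1); rewrite rmorph1 mxE eqxx => /esym e.
  by rewrite -[RHS]e; apply: eq_bigr => a _; rewrite hornerC mulr1.
have c1 : \sum_x `|c x| = 1.
  rewrite big_sumType /=.
  under eq_bigr do rewrite gtr0_norm ?divr_gt0 //.
  under [X in _ + X]eq_bigr do rewrite normrN gtr0_norm ?divr_gt0 //.
  by rewrite -!mulr_suml (w1 _ _ _ spec) (w1 _ _ _ spec'); field.
have := hpst; rewrite /pst (U_entry_spectral T HE) normc_def /= => -[sq1].
have sq : (\sum_x c x * cos (T * th x)) ^+ 2 + (\sum_x c x * sin (T * th x)) ^+ 2 = 1.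
  by rewrite -[LHS]sqr_sqrtr ?addr_ge0 ?sqr_ge0 // sq1 expr1n.
rewrite mulrBr.
apply: (extremal_phases c1 sq (j := inl i) (k := inr j)); rewrite /c.
  exact: divr_gt0.
by rewrite oppr_lt0 divr_gt0.
Qed.

Lemma path_ham_no_pst (R : realType) (m : nat) (q : nat -> R)
    (u v : 'I_((m.+1).*2)) (T : R) : (0 < m)%N ->
  val u = 0%N -> val v = (m.+1).*2.-1 -> ~ pst (path_ham (m.+1).*2 q) u v T.
Proof.
move=> m0 hu hv hpst.
have sym c : (half_path m q c)^T = half_path m q c.
  apply/matrixP => a b; rewrite !mxE orbC andbC (eq_sym b a).
  by case: (a =P b) => [->|_] //; rewrite !mul0r.
have hess c : unit_hessenberg (half_path m q c).
  move=> a b ab; rewrite !mxE -!val_eqE /=.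
  have -> : (a == b.+1 :> nat) = false by lia.
  have -> : (a == b :> nat) = false by lia.
  have -> : (a == m :> nat) = false by have := ltn_ord b; lia.
  by rewrite mul0r mulr0 subr0 addr0.
have [l [w [detE trE spec _ w0]]] := symmetric_spectrum ord0 (sym 1).
have [l' [w' [_ trE' spec' ker' w0']]] := symmetric_spectrum ord0 (sym (-1)).
have wp j : 0 < w j by rewrite lt0r w0 (hessenberg_weight_neq0 (hess 1) (sym 1) spec).
have wp' j : 0 < w' j by rewrite lt0r w0' (hessenberg_weight_neq0 (hess (-1)) (sym (-1)) spec').
have gap := pst_path_phases hu hv hpst spec spec' wp wp'.
have T0 : T != 0.
  apply/eqP => T0; have := gap ord0 ord0; rewrite T0 mul0r cos0; lra.
have /choice[f fE] : forall i, exists fi : 'I_m.+1 -> int,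
    forall j, T * (l i - l' j) = (2 * fi j + 1)%:~R * pi.
  move=> i; have /choice[fi fiE] j := cosN1_odd_pi (gap i j).
  by exists fi.
have lE i j : l i - l' j = pi / T * (2 * f i j + 1)%:~R.
  by apply: (mulfI T0); rewrite fE; field.
have rank1 : half_path m q (-1) = half_path m q 1 - 2 *: delta_mx ord_max ord_max.
  by apply/matrixP => a b; rewrite !mxE; ring.
apply: (@no_odd_gap_array R m.+1 (pi / T) f) => //.
  (* The diagonal gaps add up to the difference of the traces, which is the corner entry 2. *)
  under eq_bigr do rewrite -lE.
  rewrite sumrB -trE -trE' -raddfB rank1 opprB addrCA subrr addr0.
  rewrite /= mxtraceZ /mxtrace (bigD1 ord_max) //= big1 => [|i im].
    by rewrite mxE eqxx addr0 mulr1.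
  by rewrite mxE (negbTE im).
pose p := \prod_j ('X - (l' j)%:P).
have -> : \prod_i \prod_j (pi / T * (2 * f i j + 1)%:~R) = \det (horner_mx (half_path m q 1) p).
  rewrite detE; apply: eq_bigr => i _; rewrite horner_prod.
  by apply: eq_bigr => j _; rewrite hornerXsubC lE.
apply: det_horner_rank1; rewrite ?sym //.
- exact: monic_prod_XsubC.
- by rewrite /p -big_filter size_prod_XsubC -cardE -[in RHS](card_ord m.+1); congr _.+1; apply: eq_card.
- rewrite -rank1; apply: ker' => j.
  by rewrite horner_prod (bigD1 j) //= hornerXsubC subrr mul0r.
Qed.

Theorem theorem4 (R : realType) (n : nat) (hn : (2 <= n)%N) (q : nat -> R)
  (u v : 'I_(n.*2)) (hu : val u = 0%N) (hv : val v = (n.*2).-1) :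
  forall T : R, ~ pst (path_ham (n.*2) q) u v T.
Proof.
by case: n hn u v hu hv => [|m] // hn u v hu hv T; apply: path_ham_no_pst.
Qed.
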